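(* Let $A$ be an algebra over a field $\mathbb{F}$ with more than two elements. Then a right $A$-module $M$ is automorphism-invariant if and only if $M$ is quasi-injective.
   Context: Algebras are associative with identity; modules are unital right modules. $E(M)$ denotes the injective hull of $M$. A module $M$ is quasi-injective if every homomorphism from a submodule $L$ of $M$ to $M$ extends to an endomorphism of $M$ (equivalently, $\varphi(M)\subseteq M$ for every endomorphism $\varphi$ of $E(M)$). A module $M$ is automorphism-invariant if $\sigma(M)\subseteq M$ for every automorphism $\sigma$ of $E(M)$. *)

(* Defs.v *)
(* Right A-modules are modelled as left modules over the
   converse ring A^c (so  a *: m  means  m . a ). *)
From HB Require Import structures.
From mathcomp Require Import all_boot all_order all_algebra.
Set Implicit Arguments. Unset Strict Implicit. Unset Printing Implicit Defensive.
Import GRing.Theory.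
Local Open Scope ring_scope.

Section ModuleDefs.
Variables (F : fieldType) (A : algType F).

Definition is_submodule (M : lmodType A^c) (L : M -> Prop) : Prop :=
  L 0 /\ (forall (a : A^c) (x y : M), L x -> L y -> L (a *: x + y)).

Definition hom_on (M N : lmodType A^c) (L : M -> Prop) (f : M -> N) : Prop :=
  forall (a : A^c) (x y : M), L x -> L y -> f (a *: x + y) = a *: f x + f y.

Definition quasi_injective (M : lmodType A^c) : Prop :=
  forall (L : M -> Prop), is_submodule L ->
  forall f : M -> M, hom_on L f ->
  exists g : {linear M -> M}, forall x, L x -> g x = f x.

Definition injective_module (E : lmodType A^c) : Prop :=
  forall (N N' : lmodType A^c) (j : {linear N -> N'}) (f : {linear N -> E}),
    injective j -> exists g : {linear N' -> E}, forall x, g (j x) = f x.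

Definition essential_mono (M E : lmodType A^c) (iota : {linear M -> E}) : Prop :=
  forall (N : E -> Prop), is_submodule N ->
    (forall m, N (iota m) -> iota m = 0) -> forall x, N x -> x = 0.

Definition injective_hull (M E : lmodType A^c) (iota : {linear M -> E}) : Prop :=
  [/\ injective iota, injective_module E & essential_mono iota].

Definition automorphism_invariant (M : lmodType A^c) : Prop :=
  forall (E : lmodType A^c) (iota : {linear M -> E}), injective_hull iota ->
  forall sigma : {linear E -> E}, bijective sigma ->
  forall m : M, exists m' : M, sigma (iota m) = iota m'.

End ModuleDefs.

(* Main.v *)
(* The nontrivial direction holds in the following form: if M is a submodule of
   an injective module E and every automorphism of E maps M into M, so does
   every endomorphism f.  The endomorphisms preserving M form a ring
   containing all automorphisms, hence all n with n^2 = 0 (as 1 + n is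
   invertible), all n with essential kernel, and all idempotents e: for c in F
   with c <> 0, 1 the map e - c is invertible.
   Choose N maximal among the submodules such that x = f y with x, y in N
   forces y = 0.  Maximality makes N a direct summand, f is injective on N, and
   E = N + f(N) + X is a direct sum with projections p1, p2, p3.  Up to
   adding maps of square zero, f is p1 f p1 + p2 f p2 + p3 f p3.  Here p1 f p1 = 0, and p2 f p2
   is a product of two maps of square zero because f(N) is isomorphic to N.  By
   maximality of N, every nonzero x in X has b with b x <> 0 and p3 f (b x) in A x;
   so, away from the injective hull of its kernel, p3 f p3 is injective with
   essential image, hence an automorphism of a direct summand.
   Injective hulls are cut out of Hom_F(A, M), which is injective because every
   F-vector space is. *)
Require Import Defs.
From HB Require Import structures.
From mathcomp Require Import all_boot all_order all_algebra.
From mathcomp Require Import boolp classical_sets functions.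
Import GRing.Theory.
Local Open Scope ring_scope.

(** * Submodules and maximal submodules by Zorn's lemma *)

Section Submodules.
Set Implicit Arguments.
Unset Strict Implicit.
Variables (R : pzRingType) (V : lmodType R).
Implicit Types (L B : V -> Prop) (r : V -> V -> Prop).

Definition submod L : Prop :=
  L 0 /\ (forall (a : R) x y, L x -> L y -> L (a *: x + y)).

Definition pairwise r L : Prop := forall x y, L x -> L y -> r x y.

Lemma submod0 L : submod L -> L 0. Proof. by case. Qed.

Lemma submodZ L a x : submod L -> L x -> L (a *: x).
Proof. by move=> [L0 LP] Lx; rewrite -[_ *: _]addr0; apply: LP. Qed.

Lemma submodD L x y : submod L -> L x -> L y -> L (x + y).
Proof. by move=> [_ LP] Lx Ly; rewrite -[x]scale1r; apply: LP. Qed.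

Lemma submodN L x : submod L -> L x -> L (- x).
Proof. by move=> Ls Lx; rewrite -scaleN1r; apply: submodZ. Qed.

Lemma submodB L x y : submod L -> L x -> L y -> L (x - y).
Proof. by move=> Ls Lx Ly; apply: submodD => //; apply: submodN. Qed.

Lemma submod_add_span L x :
  submod L -> submod (fun z => exists a n, L n /\ z = a *: x + n).
Proof.
move=> Ls; split; first by exists 0, 0; rewrite scale0r addr0; split=> //; case: Ls.
move=> b _ _ [a1 [n1 [L1 ->]]] [a2 [n2 [L2 ->]]].
exists (b * a1 + a2), (b *: n1 + n2); split; first by case: Ls => _; apply.
by rewrite scalerDr scalerA scalerDl addrACA.
Qed.

Lemma submod_ker (W : lmodType R) (f : {linear V -> W}) :
  submod (fun x => f x = 0).
Proof.
split=> [|a x y fx fy]; first by rewrite raddf0.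
by rewrite linearP fx fy scaler0 addr0.
Qed.

Lemma submod_im (W : lmodType R) (f : {linear W -> V}) :
  submod (fun y => exists x, y = f x).
Proof.
split=> [|a _ _ [x ->] [y ->]]; first by exists 0; rewrite raddf0.
by exists (a *: x + y); rewrite linearP.
Qed.

Lemma submod_fix (e : {linear V -> V}) : submod (fun x => e x = x).
Proof.
split=> [|a x y ex ey]; first by rewrite raddf0.
by rewrite linearP ex ey.
Qed.

(** Any two elements of the union of a chain lie in one member, so a condition on pairs survives
    unions and Zorn's lemma applies. A condition on single elements is the case where [r] ignores
    its second argument. *)
Lemma max_submod r B : submod B -> pairwise r B ->
  exists L, [/\ submod L, (forall x, B x -> L x), pairwise r L &
    forall L', submod L' -> (forall x, L x -> L' x) -> pairwise r L' ->
      forall x, L' x -> L x].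
Proof.
move=> Bs Br.
pose good L := [/\ submod L, (forall x, B x -> L x) & pairwise r L].
pose P : set (set V) := fun L => L = set0 \/ good L.
have goodB : good B by split.
have [F FP Ft|L [PL Lmax]] := @Zorn_bigcup V P.
  have [[X [FX gX]]|nog] := pselect (exists X, F X /\ good X); last first.
    left; apply/seteqP; split=> // x [X FX Xx].
    by have [X0|gX] := FP _ FX; [rewrite X0 in Xx | case: nog; exists X].
  right; have two x y : (\bigcup_(Z in F) Z)%classic x ->
      (\bigcup_(Z in F) Z)%classic y -> exists Z, [/\ F Z, good Z, Z x & Z y].
    move=> [Y FY Yx] [Z FZ Zy].
    have [YZ|ZY] := Ft _ _ FY FZ.
      have [Z0|gZ] := FP _ FZ; first by rewrite Z0 in Zy.
      by exists Z; split=> //; apply: YZ.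
    have [Y0|gY] := FP _ FY; first by rewrite Y0 in Yx.
    by exists Y; split=> //; apply: ZY.
  split.
  - split; first by exists X => //; case: gX => [[]].
    move=> a x y Ux Uy; have [Z [FZ [[_ Zs] _ _] Zx Zy]] := two _ _ Ux Uy.
    by exists Z => //; apply: Zs.
  - by move=> x Bx; exists X => //; case: gX => _ + _; apply.
  - by move=> x y Ux Uy; have [Z [_ [_ _ +] Zx Zy]] := two _ _ Ux Uy; apply.
have gL : good L.
  case: PL => // L0; case: (Lmax B); last by right.
  split; first by move=> x; rewrite L0.
  by move=> BL; have := BL 0 (submod0 Bs); rewrite L0.
exists L; case: (gL) => Ls BL Lr; split=> // L' L's LL' L'r x L'x.
apply: contrapT => nLx; apply: (Lmax L'); last first.
  by right; split=> // z Bz; apply/LL'/BL.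
by split=> [//|L'L]; apply/nLx/L'L.
Qed.

(** Take [C] maximal among the submodules meeting [N] in 0. If [x] is outside [C], adjoining it must
    create a nonzero intersection with [N]. *)
Lemma max_complement N : submod N -> exists C, [/\ submod C,
  (forall x, C x -> N x -> x = 0) &
  forall x, ~ C x -> exists a c, [/\ C c, N (a *: x + c) & a *: x + c <> 0]].
Proof.
move=> Ns; pose r (x y : V) := N x -> x = 0.
have [||C [Cs _ Cr Cmax]] := @max_submod r (fun x => x = 0).
- by split=> // a x y -> ->; rewrite scaler0 addr0.
- by move=> x y ->.
exists C; split=> // [x Cx|x nCx]; first exact: (Cr x x).
apply: contrapT => noC; apply: nCx.
apply: (Cmax _ (submod_add_span x Cs)) => [c Cc|_ y [a [c [Cc ->]]] _ Nac|].
- by exists 0, c; rewrite scale0r add0r.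
- by apply: contrapT => nz; apply: noC; exists a, c.
- by exists 1, 0; rewrite scale1r addr0; split=> //; case: Cs.
Qed.

End Submodules.

(** * Linear maps given by their graphs *)

Section LinearGraphs.
Set Implicit Arguments.
Unset Strict Implicit.
Variables (R : pzRingType) (V W : lmodType R).

Lemma linear_fun (f : V -> W) : (forall a x y, f (a *: x + y) = a *: f x + f y) ->
  exists g : {linear V -> W}, forall x, g x = f x.
Proof.
move=> fP; pose fL := GRing.isLinear.Build R V W *:%R f fP.
pose g : {linear V -> W} := HB.pack f fL.
by exists g.
Qed.

(** Graphs of linear maps defined on a submodule of [V]: by additivity, single-valuedness need only
    be required at 0. *)
Definition linear_rel (G : V -> W -> Prop) : Prop :=
  [/\ G 0 0, (forall a x y x' y', G x y -> G x' y' -> G (a *: x + x') (a *: y + y'))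
   & forall y, G 0 y -> y = 0].

Lemma linear_rel_functional G x y y' : linear_rel G -> G x y -> G x y' -> y = y'.
Proof.
case=> _ GP G0 Gy Gy'; apply/eqP; rewrite -subr_eq0; apply/eqP/G0.
have := GP (-1) _ _ _ _ Gy' Gy; rewrite !scaleN1r.
by rewrite addNr addrC.
Qed.

Lemma total_linear_rel G : linear_rel G -> (forall x, exists y, G x y) ->
  exists g : {linear V -> W}, forall x y, G x y -> g x = y.
Proof.
move=> GP /choice[f Gf]; have [|g gE] := @linear_fun f.
  move=> a x y; apply: (linear_rel_functional GP (Gf _)).
  by case: GP => _ + _; apply; apply: Gf.
by exists g => x y Gxy; rewrite gE; apply: (linear_rel_functional GP (Gf _)).
Qed.

End LinearGraphs.

(** * Submodules as modules in their own right *)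

Record submodule (R : pzRingType) (V : lmodType R) :=
  Submodule { carrier : V -> Prop; carrierP : submod carrier }.

Section SubmoduleType.
Set Implicit Arguments.
Unset Strict Implicit.
Variables (R : pzRingType) (V : lmodType R) (S : submodule V).

Definition submodule_pred : {pred V} := fun x => `[< carrier S x >].

Fact submodule_pred_closed : GRing.submod_closed submodule_pred.
Proof.
case: (carrierP S) => S0 SP; split=> [|a x y]; first exact/asboolP.
by move=> /asboolP Sx /asboolP Sy; apply/asboolP/SP.
Qed.

HB.instance Definition _ :=
  GRing.isSubmodClosed.Build R V submodule_pred submodule_pred_closed.

Definition submodule_type : Type := {x : V | submodule_pred x}.
HB.instance Definition _ := [isSub of submodule_type for @sval _ _].
HB.instance Definition _ := [Choice of submodule_type by <:].
HB.instance Definition _ := [SubChoice_isSubLmodule of submodule_type by <:].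

Lemma submodule_valP (u : submodule_type) : carrier S (val u).
Proof. exact/asboolP/(valP u). Qed.

Lemma submodule_sub x (Sx : carrier S x) : exists u : submodule_type, val u = x.
Proof. by exists (Sub x (asboolT Sx)); rewrite SubK. Qed.

End SubmoduleType.

(** * Restriction of scalars from the algebra to the field *)

Section ScalarRestriction.
Set Implicit Arguments.
Unset Strict Implicit.
Variables (F : fieldType) (A : algType F).

Definition scalar (c : F) : A^c := (c%:A : A).

Lemma scalar1 : scalar 1 = 1. Proof. by rewrite /scalar scale1r. Qed.
Lemma scalarD c d : scalar (c + d) = scalar c + scalar d.
Proof. exact: scalerDl. Qed.
Lemma scalarM c d : scalar (c * d) = scalar c * scalar d.
Proof.
have -> : scalar c * scalar d = (d%:A : A) * c%:A by [].
by rewrite -scalerAl mul1r scalerA mulrC.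
Qed.
Lemma scalar_mull c (a : A) : scalar c * (a : A^c) = (c *: a : A).
Proof. by have -> : scalar c * (a : A^c) = a * c%:A by []; rewrite -scalerAr mulr1. Qed.
Lemma scalar_mulr c (a : A) : (a : A^c) * scalar c = (c *: a : A).
Proof. by have -> : (a : A^c) * scalar c = c%:A * a by []; rewrite -scalerAl mul1r. Qed.
Lemma scalarC c (a : A^c) : scalar c * a = a * scalar c.
Proof. by rewrite scalar_mull scalar_mulr. Qed.

(* M as a vector space over F. *)
Definition restrict (M : lmodType A^c) : Type := M.
Variable M : lmodType A^c.
HB.instance Definition _ := GRing.Zmodule.on (restrict M).
Definition restrict_scale (c : F) (m : restrict M) : restrict M :=
  scalar c *: (m : M).

Fact restrict_scaleA c d m :
  restrict_scale c (restrict_scale d m) = restrict_scale (c * d) m.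
Proof. by rewrite /restrict_scale scalerA scalarM. Qed.
Fact restrict_scale1 : left_id 1 restrict_scale.
Proof. by move=> m; rewrite /restrict_scale scalar1 scale1r. Qed.
Fact restrict_scaleDr : right_distributive restrict_scale +%R.
Proof. by move=> c m n; rewrite /restrict_scale -scalerDr. Qed.
Fact restrict_scaleDl m : {morph restrict_scale^~ m : c d / c + d}.
Proof. by move=> c d; rewrite /restrict_scale scalarD; exact: scalerDl. Qed.
HB.instance Definition _ := GRing.Zmodule_isLmodule.Build F (restrict M)
  restrict_scaleA restrict_scale1 restrict_scaleDr restrict_scaleDl.

Lemma restrictE (c : F) (m : restrict M) : c *: m = scalar c *: (m : M).
Proof. by []. Qed.

Lemma restrict_act (c : F) (a b : A) (m : M) :
  ((c *: a + b : A) : A^c) *: m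
  = c *: ((a : A^c) *: m : restrict M) + ((b : A^c) *: m : restrict M).
Proof.
rewrite restrictE scalerA scalar_mull.
exact: (scalerDl m (c *: a : A) (b : A^c)).
Qed.

End ScalarRestriction.

(** * Injectivity of vector spaces *)

Section FieldExtension.
Set Implicit Arguments.
Unset Strict Implicit.
Variables (F : fieldType) (U V W : lmodType F).

(** Over a field a maximal complement [C] of the image of [j] is a true complement; [G] is the map
    that follows [f] on the image of [j] and vanishes on [C]. *)
Lemma vspace_injective (j : {linear U -> V}) (f : {linear U -> W}) :
  injective j -> exists g : {linear V -> W}, forall x, g (j x) = f x.
Proof.
move=> jinj.
have [C [Cs Cj Cmax]] := max_complement (submod_im j).
pose G x y := exists u c, [/\ C c, x = j u + c & y = f u].
have GP : linear_rel G.
  split.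
  - by exists 0, 0; rewrite !raddf0 addr0; split=> //; apply: submod0.
  - move=> a _ _ _ _ [u [c [Cc -> ->]]] [u' [c' [Cc' -> ->]]].
    exists (a *: u + u'), (a *: c + c'); rewrite !linearP scalerDr addrACA.
    by split=> //; case: Cs => _; apply.
  - move=> _ [u [c [Cc /esym/eqP + ->]]]; rewrite addrC addr_eq0 => /eqP cE.
    have c0 : c = 0 by apply: Cj => //; exists (- u); rewrite raddfN.
    have -> : u = 0 by apply: jinj; rewrite raddf0; apply/oppr_inj; rewrite oppr0 -cE.
    by rewrite raddf0.
have [|g gG] := total_linear_rel GP.
  move=> x; have [Cx|/Cmax[a [c [Cc [u uE] nz]]]] := pselect (C x).
    by exists 0, 0, x; rewrite !raddf0 add0r.
  have [a0|an0] := eqVneq a 0.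
    case: nz; rewrite a0 scale0r add0r; apply: Cj => //.
    by exists u; rewrite -uE a0 scale0r add0r.
  (* This solves [a *: x + c = j u] for [x]. *)
  exists (f (a^-1 *: u)), (a^-1 *: u), (- a^-1 *: c); split=> //.
    exact: submodZ.
  by rewrite linearZ -uE /= scalerDr scalerA mulVf // scale1r scaleNr addrK.
exists g => x; apply: gG; exists x, 0; rewrite addr0; split=> //.
exact: submod0.
Qed.

End FieldExtension.

(** * The coinduced module and its injectivity *)

Section Coinduced.
Set Implicit Arguments.
Unset Strict Implicit.
Variables (F : fieldType) (A : algType F) (M : lmodType A^c).


Definition is_linear_fun (f : A -> restrict M) : Prop :=
  forall (c : F) (a b : A), f (c *: a + b) = c *: f a + f b.
Definition linear_funs : {pred A -> restrict M} := fun f => `[< is_linear_fun f >].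

Fact linear_funs_closed : GRing.zmod_closed linear_funs.
Proof.
split=> [|f g /asboolP fP /asboolP gP]; apply/asboolP=> c a b.
  by rewrite -[RHS]/(c *: 0 + 0) scaler0 addr0.
rewrite -[LHS]/(f (c *: a + b) - g (c *: a + b)).
rewrite -[RHS]/(c *: (f a - g a) + (f b - g b)).
by rewrite fP gP scalerBr opprD addrACA.
Qed.
HB.instance Definition _ :=
  GRing.isZmodClosed.Build (A -> restrict M) linear_funs linear_funs_closed.

(* Hom_F(A, M), a right A-module by (f . a)(x) = f (a x). *)
Definition coinduced : Type := {f : A -> restrict M | linear_funs f}.
HB.instance Definition _ := [isSub of coinduced for @sval _ _].
HB.instance Definition _ := [Choice of coinduced by <:].
HB.instance Definition _ := [SubChoice_isSubZmodule of coinduced by <:].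

Lemma coinduced_linear (f : coinduced) : is_linear_fun (val f).
Proof. exact/asboolP/(valP f). Qed.

Lemma coinduced_scale (f : coinduced) (c : F) a : val f (c *: a) = c *: val f a.
Proof.
have f0 : val f 0 = 0.
  apply: (addIr (val f 0)); rewrite -{1}[val f 0]scale1r -coinduced_linear.
  by rewrite scaler0 !add0r.
by rewrite -[c *: a]addr0 coinduced_linear f0 addr0.
Qed.

Lemma coinducedP (f g : coinduced) : (forall a, val f a = val g a) -> f = g.
Proof. by move=> fg; apply/val_inj/funext. Qed.

Fact shift_linear (a : A^c) (f : coinduced) :
  linear_funs (fun x : A => val f ((a : A) * x)).
Proof.
by apply/asboolP=> c x y; rewrite mulrDr -scalerAr coinduced_linear.
Qed.
Definition shift a f : coinduced := Sub _ (shift_linear a f).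

Fact shiftA a b f : shift a (shift b f) = shift (a * b) f.
Proof. by apply: coinducedP => x /=; rewrite mulrA. Qed.
Fact shift1 : left_id 1 shift.
Proof. by move=> f; apply: coinducedP => x /=; rewrite mul1r. Qed.
Fact shiftDr : right_distributive shift +%R.
Proof. by move=> a f g; apply: coinducedP. Qed.
Fact shiftDl f : {morph shift^~ f : a b / a + b}.
Proof.
move=> a b; apply: coinducedP => x /=; rewrite mulrDl.
by rewrite -[(a : A) * x]scale1r coinduced_linear scale1r.
Qed.
HB.instance Definition _ := GRing.Zmodule_isLmodule.Build A^c coinduced
  shiftA shift1 shiftDr shiftDl.

Lemma coinducedZ (a : A^c) (f : coinduced) x : val (a *: f) x = val f ((a : A) * x).
Proof. by []. Qed.

(** Evaluation at 1 identifies the [A]-linear maps from a module to [coinduced] with the [F]-linear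
    maps from it to [M]. So [f] becomes an [F]-linear map, which extends to [gF], and [gF]
    corresponds to the map sending [n] to the function [a |-> gF (a *: n)]. *)
Lemma coinduced_injective : injective_module coinduced.
Proof.
move=> N N' j f jinj.
have restrict_linear (X Y : lmodType A^c) (h : {linear X -> Y}) :
    exists h' : {linear restrict X -> restrict Y}, forall x, h' x = h x.
  by apply: linear_fun => c x y; rewrite !restrictE linearP.
have [jF jE] := restrict_linear _ _ j.
have [|fF fE] := @linear_fun F (restrict N) (restrict M) (fun n => val (f n) 1).
  move=> c x y; rewrite restrictE linearP.
  rewrite -[LHS]/(val (f x) (c%:A * 1) + val (f y) 1).
  by rewrite mulr1 coinduced_scale.
have [|gF gE] := @vspace_injective _ _ _ _ jF fF.
  by move=> x y; rewrite !jE => /jinj.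
have hP (n : N') : linear_funs (fun a : A => gF ((a : A^c) *: n)).
  apply/asboolP=> c a b.
  by rewrite restrict_act linearP.
have [|g gP] := @linear_fun A^c N' coinduced (fun n => Sub _ (hP n)).
  move=> b x y; apply: coinducedP => a.
  rewrite /= scalerDr scalerA raddfD; congr (_ + _).
exists g => n; rewrite gP; apply: coinducedP => a.
rewrite /= -linearZ -jE gE fE linearZ coinducedZ mulr1 //.
Qed.

(** Send [m] to the function [a |-> a *: m], whose value at 1 recovers [m]. *)
Lemma coinduced_embedding : exists j : {linear M -> coinduced}, injective j.
Proof.
have jP (m : M) : linear_funs (fun a : A => (a : A^c) *: m).
  apply/asboolP=> c a b.
  exact: restrict_act.
have [|j jE] := @linear_fun A^c M coinduced (fun m => Sub _ (jP m)).
  by move=> b x y; apply: coinducedP => a; rewrite /= scalerDr scalerA.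
exists j => x y; rewrite !jE => /(congr1 (fun f : coinduced => val f 1)) /=.
by rewrite !scale1r.
Qed.

End Coinduced.

(** * Injective modules, hulls inside them, and existence of injective hulls *)

Section InjectiveModules.
Set Implicit Arguments.
Unset Strict Implicit.
Variables (F : fieldType) (A : algType F).

(** Injectivity is applied to the inclusion of the domain of [G] in [V]. *)
Lemma extend_linear_rel (V E : lmodType A^c) (G : V -> E -> Prop) :
  injective_module E -> linear_rel G ->
  exists g : {linear V -> E}, forall x y, G x y -> g x = y.
Proof.
move=> Einj GP; have [G0 GL _] := GP.
have Ds : submod (fun x => exists y, G x y).
  split=> [|a x x' [y Gy] [y' Gy']]; first by exists 0.
  by exists (a *: y + y'); apply: GL.
pose D := Submodule Ds.
pose H (u : submodule_type D) y := G (val u) y.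
have HP : linear_rel H.
  split=> [|a x y x' y'|y]; rewrite /H ?raddf0 //; first exact: GL.
  by case: GP => _ _; apply.
have [|f fH] := @total_linear_rel _ (submodule_type D) E H HP.
  by move=> u; exact: (submodule_valP u).
have [g gf] := Einj _ _ (val : {linear submodule_type D -> V}) f val_inj.
exists g => x y Gxy.
have [|u ux] := @submodule_sub _ _ D x; first by exists y.
by rewrite -ux gf; apply: fH; rewrite /H ux.
Qed.

Lemma retract_injective (E Q : lmodType A^c)
    (i : {linear E -> Q}) (p : {linear Q -> E}) :
  injective_module Q -> (forall x, p (i x) = x) -> injective_module E.
Proof.
move=> Qinj pi N N' j f jinj.
have [g gP] := Qinj _ _ j (i \o f : {linear N -> Q}) jinj.
by exists (p \o g : {linear N' -> E}) => x; rewrite /= gP /= pi.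
Qed.

Definition essential (E : lmodType A^c) (N L : E -> Prop) : Prop :=
  forall x, L x -> x <> 0 -> exists a, N (a *: x) /\ a *: x <> 0.

(** Let [L] be a maximal essential extension of [N] in [E] and [C] a maximal complement of [L]. The
    projection of [L + C] onto [L] extends to [g] on [E]. The image of [g] is again essential over
    [N], so it equals [L] and [g] is idempotent. *)
Lemma hull_idempotent (E : lmodType A^c) (N : E -> Prop) :
  injective_module E -> submod N ->
  exists e : {linear E -> E}, [/\ forall x, e (e x) = e x,
    forall x, N x -> e x = x & essential N (fun x => e x = x)].
Proof.
move=> Einj Ns.
pose r (x _ : E) := x <> 0 -> exists a, N (a *: x) /\ a *: x <> 0.
have [|L [Ls NL Lr Lmax]] := @max_submod _ _ r N Ns.
  by move=> x _ Nx _ x0; exists 1; rewrite scale1r.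
have [C [Cs CL Cmax]] := max_complement Ls.
pose G x y := exists2 c, C c & L y /\ x = y + c.
have GP : linear_rel G.
  split.
  - exists 0; first exact: submod0.
    by rewrite addr0; split=> //; apply: submod0.
  - move=> a _ y _ y' [c Cc [Ly ->]] [c' Cc' [Ly' ->]].
    exists (a *: c + c'); first by case: Cs => _; apply.
    by rewrite scalerDr addrACA; split=> //; case: Ls => _; apply.
  - move=> y [c Cc [Ly /esym/eqP +]]; rewrite addr_eq0 => /eqP yE.
    have Lc : L c by rewrite -(opprK c) -yE; apply: submodN.
    by rewrite yE (CL c) ?oppr0.
have [g gG] := extend_linear_rel Einj GP.
have gL y : L y -> g y = y.
  by move=> Ly; apply: gG; exists 0; rewrite ?addr0; split || apply: submod0.
have gC c : C c -> g c = 0.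
  move=> Cc; apply: gG; exists c; rewrite ?add0r //; split=> //.
  exact: submod0.
have imL x : L (g x).
  apply: (Lmax _ (submod_im g)) => [y Ly||]; last by exists x.
    by exists y; rewrite gL.
  move=> _ _ [z ->] _ gz0.
  (* Outside [C], some nonzero [a *: z + c] lies in [L]; as [g] fixes [L] and kills [C], this
     element is the multiple [a *: g z]. *)
  have [Cz|/Cmax[a [c [Cc Lac nz]]]] := pselect (C z); first by case: gz0; apply: gC.
  have agz : a *: g z = a *: z + c.
    by rewrite -(gL _ Lac) linearP (gC c) // addr0.
  have [b] := Lr _ 0 Lac (submod0 Ls) nz.
  by rewrite -agz scalerA; exists (b * a).
exists g; split=> [x|x Nx|x gx].
- exact: gL.
- exact/gL/NL.
- by apply: (Lr x 0); [rewrite -gx | apply: submod0].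
Qed.

(** The hull is the summand of [coinduced M] fixed by the idempotent belonging to the image of
    [M]. *)
Lemma injective_hull_exists (M : lmodType A^c) :
  exists (E : lmodType A^c) (iota : {linear M -> E}), injective_hull iota.
Proof.
have [j jinj] := coinduced_embedding M.
have Qinj := @coinduced_injective F A M.
have [e [ee ej ess]] := hull_idempotent Qinj (submod_im j).
pose S := Submodule (submod_fix e); pose E := submodule_type S.
have [||p pE] := @total_linear_rel _ (coinduced M) E (fun x u => val u = e x).
- split=> [|a x u y v /= ux vy|u u0]; first by rewrite !raddf0.
    by rewrite linearP -ux -vy.
  by apply: val_inj; rewrite u0 !raddf0.
- by move=> x; apply: (@submodule_sub _ _ S).
have Einj : injective_module E.
  apply: (retract_injective (i := val : {linear E -> coinduced M}) (p := p)) => // u.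
  by apply: pE; rewrite (submodule_valP u).
have valp x : val (p x) = e x.
  have [|u ux] := @submodule_sub _ _ S (e x); first exact: ee.
  by rewrite (pE _ u).
pose iota : {linear M -> E} := p \o j.
have iotaE m : val (iota m) = j m by rewrite /= valp ej //; exists m.
exists E, iota; split=> // [m n mn|N Ns N0 x Nx].
  by apply: jinj; rewrite -!iotaE mn.
apply: contrapT => x0.
have [|a [[m am] nz]] := ess (val x) (submodule_valP x).
  by move=> vx0; apply/x0/val_inj; rewrite vx0 raddf0.
have ax : a *: x = iota m by apply: val_inj; rewrite iotaE -am linearZ.
have ax0 : a *: x = 0 by rewrite ax N0 // -ax; apply: submodZ.
by case: nz; have := congr1 val ax0; rewrite linearZ raddf0.
Qed.

(** Injectivity gives a left inverse [h]. If [g (h x) - x] were nonzero, some nonzero multiple of it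
    would be [g z]; but [h] kills that multiple, so [z = 0]. *)
Lemma injective_endo_bij (E : lmodType A^c) (g : {linear E -> E}) :
  injective_module E -> injective g ->
  essential (fun y => exists x, y = g x) (fun=> True) -> bijective g.
Proof.
move=> Einj ginj ess.
have [h hg] := Einj _ _ g (idfun : {linear E -> E}) ginj.
exists h => // x; apply/eqP; rewrite -subr_eq0; apply/eqP.
apply: contrapT => /(ess _ I)[a [[z az]]]; apply; rewrite az.
have := congr1 h az; rewrite linearZ raddfB /= !hg subrr scaler0 /= => <-.
by rewrite raddf0.
Qed.

End InjectiveModules.

(** * Endomorphisms preserving an automorphism-stable submodule *)

Section PreservedSubmodule.
Set Implicit Arguments.
Unset Strict Implicit.
Variables (F : fieldType) (A : algType F) (E : lmodType A^c) (M : E -> Prop).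
Hypotheses (Einj : injective_module E) (Ms : submod M).
Hypothesis Minv :
  forall s : {linear E -> E}, bijective s -> forall x, M x -> M (s x).

Definition preserves (f : E -> E) : Prop := forall x, M x -> M (f x).

Lemma preserves_add f g h : preserves f -> preserves g ->
  (forall x, h x = f x + g x) -> preserves h.
Proof.
by move=> fM gM hE x Mx; rewrite hE; apply: submodD => //; [apply: fM|apply: gM].
Qed.

Lemma preserves_shift (n : {linear E -> E}) (s : {linear E -> E}) :
  bijective s -> (forall x, s x = x + n x) -> preserves n.
Proof.
move=> sbij sE x Mx; have -> : n x = s x - x by rewrite sE addrAC subrr add0r.
by apply: submodB => //; apply: Minv.
Qed.

Lemma preserves_square_zero (n : {linear E -> E}) :
  (forall x, n (n x) = 0) -> preserves n.
Proof.
move=> nn; apply: (@preserves_shift n (idfun \+ n)) => //.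
exists (idfun \- n) => x /=.
  by rewrite raddfD /= nn addr0 addrK.
by rewrite raddfB /= nn subr0 subrK.
Qed.

Lemma preserves_essential_ker (n : {linear E -> E}) :
  essential (fun x => n x = 0) (fun=> True) -> preserves n.
Proof.
move=> ess; apply: (@preserves_shift n (idfun \+ n)) => //.
apply: injective_endo_bij => // [|x _ /(ess _ I)[a [na nz]]]; last first.
  by exists a; split=> //; exists (a *: x); rewrite /= na addr0.
apply: raddf_inj => x /= xn; apply: contrapT => /(ess _ I)[a [na]]; apply.
have -> : a *: x = a *: (x + n x) - n (a *: x) by rewrite scalerDr linearZ addrK.
by rewrite xn scaler0 na subr0.
Qed.

(** The difference [f p - p f p] has square zero, because its image is killed by [p]. *)
Lemma preserves_corner (p f : {linear E -> E}) : (forall x, p (p x) = p x) ->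
  preserves (fun x => p (f (p x))) -> preserves (f \o p).
Proof.
move=> pp corner.
apply: (preserves_add corner
  (@preserves_square_zero ((f \o p) \- (p \o f \o p) : {linear E -> E}) _)).
  move=> x /=; have -> : p (f (p x) - p (f (p x))) = 0.
    by rewrite raddfB /= pp subrr.
  by rewrite !raddf0 addr0.
by move=> x /=; rewrite addrC subrK.
Qed.

Variable c : F.
Hypotheses (c_neq0 : c != 0) (c_neq1 : c != 1).

Lemma preserves_idempotent (e : {linear E -> E}) :
  (forall x, e (e x) = e x) -> preserves e.
Proof.
move=> ee.
have sc (d : F) : exists g : {linear E -> E}, forall x, g x = scalar A d *: x.
  by apply: linear_fun => a x y; rewrite scalerDr !scalerA scalarC.
have [g gE] := sc (- c).
have Mg' : preserves (fun x => scalar A c *: x) by move=> x Mx; apply: submodZ.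
have scaK d x : d != 0 -> scalar A d *: (scalar A d^-1 *: x) = x.
  by move=> d0; rewrite scalerA -scalarM divff // scalar1 scale1r.
have scaVK d x : d != 0 -> scalar A d^-1 *: (scalar A d *: x) = x.
  by move=> d0; rewrite scalerA -scalarM mulVf // scalar1 scale1r.
have gN x : g x = - (scalar A c *: x).
  by rewrite gE /scalar scaleNr; exact: scaleNr.
have g1 x : x + g x = scalar A (1 - c) *: x.
  by rewrite gE scalarD scalar1 scalerDl scale1r.
have d0 : 1 - c != 0 by rewrite subr_eq0 eq_sym.
apply: (@preserves_add (e \+ g : {linear E -> E}) _ _ _ Mg'); last first.
  by move=> x; rewrite /= gN subrK.
apply: Minv.
(* The map [e - c] is multiplication by [1 - c] on the image of [e] and by [- c] on its kernel; each
   is inverted separately. *)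
exists (fun x => scalar A (1 - c)^-1 *: e x - scalar A c^-1 *: (x - e x)) => x /=.
  have -> : e (e x + g x) = scalar A (1 - c) *: e x.
    rewrite raddfD /= ee -g1 !gN; congr (_ + _); rewrite raddfN.
    by congr (- _); exact: linearZ.
  rewrite scaVK // -g1 opprD addrACA subrr add0r -raddfB /= gN scalerN scaVK //.
  by rewrite opprK addrC subrK.
have eZ a z : e (a *: z) = a *: e z by exact: linearZ.
have eB z z' : e (z - z') = e z - e z' by exact: raddfB.
rewrite eB !eZ eB !ee subrr scaler0 subr0 gN scalerBr scaK //.
by rewrite opprB addrCA -gN g1 scaK // subrK.
Qed.


(** Let [k] project onto a hull of the kernel of [f], and let [t = 1 - k]. Then [f k] has essential
    kernel, while [t f t] is injective with essential image on the image of [t]. Hence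
    [u = t f t + k] is an automorphism, and [t f t = u t] preserves [M]. *)
Lemma preserves_locally_scalar (p f : {linear E -> E}) :
  (forall x, p (p x) = p x) -> (forall x, f (p x) = f x) ->
  (forall x, p x = x -> x <> 0 -> exists a b, b *: x <> 0 /\ f (b *: x) = a *: x) ->
  preserves f.
Proof.
move=> pp fp loc.
have [k [kk fk ess]] := hull_idempotent Einj (submod_ker f).
have [t tE] : exists t : {linear E -> E}, forall x, t x = x - k x.
  by exists (idfun \- k).
have kt x : k (t x) = 0 by rewrite tE raddfB /= kk subrr.
have tk x : t (k x) = 0 by rewrite tE kk subrr.
have tt x : t (t x) = t x by rewrite {1}tE kt subr0.
have tf0 x : f x = 0 -> t x = 0 by move=> /fk kx; rewrite tE kx subrr.
have fkM : preserves (f \o k).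
  apply: (@preserves_essential_ker (f \o k)) => x _ x0.
  have [kx0|kx0] := pselect (k x = 0).
    by exists 1; rewrite scale1r /= kx0 raddf0.
  have [a [fa az]] := ess (k x) (kk x) kx0.
  exists a; rewrite /= linearZ; split=> //.
  by move=> ax0; apply: az; rewrite -linearZ /= ax0 raddf0.
have lZ (h : {linear E -> E}) a x : h (a *: x) = a *: h x by exact: linearZ.
(* Since [f p = f], the element [x - p x] lies in the kernel of [f], which [t] kills. This transfers
   the local hypothesis from the image of [p] to that of [t]. *)
have tp x : t x = x -> t (p x) = x.
  move=> tx; apply/eqP; rewrite -{2}tx -subr_eq0 -raddfB; apply/eqP/tf0.
  by rewrite raddfB /= fp subrr.
have loct x : t x = x -> x <> 0 -> exists a b, b *: x <> 0 /\ f (b *: x) = p (a *: x).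
  move=> tx x0; have px0 : p x <> 0.
    by move=> px; apply: x0; rewrite -tx; apply: tf0; rewrite -fp px raddf0.
  have [a [b [bz fb]]] := loc (p x) (pp x) px0.
  exists a, b; split; first by move=> bx0; apply: bz; rewrite -lZ bx0 raddf0.
  by rewrite -fp lZ fb lZ.
have tfinj x : t x = x -> t (f x) = 0 -> x = 0.
  move=> tx tfx; apply: contrapT => x0.
  have [a [b [bz fb]]] := loct x tx x0; apply: bz.
  rewrite -tx -lZ; apply: tf0; rewrite fb.
  have <- : t (p (a *: x)) = a *: x by apply: tp; rewrite lZ tx.
  by rewrite -fb !lZ tfx raddf0 scaler0.
have [u uE] : exists u : {linear E -> E}, forall x, u x = t (f (t x)) + k x.
  by exists ((t \o f \o t) \+ k).
have ubij : bijective u.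
  apply: injective_endo_bij => //.
    apply: raddf_inj => x /=; rewrite uE => ux0.
    have tu : t (f (t x)) = 0.
      by have := congr1 t ux0; rewrite raddfD /= tt tk addr0 raddf0.
    have kx0 : k x = 0 by move: ux0; rewrite tu add0r.
    by have := tfinj (t x) (tt x) tu; rewrite tE kx0 subr0.
  move=> x _ x0; have [tx0|tx0] := pselect (t x = 0).
    exists 1; rewrite scale1r; split=> //; exists x.
    by rewrite uE tx0 !raddf0 add0r; apply/eqP; rewrite -subr_eq0 -tE tx0.
  have [a [b [bz fb]]] := loct (t x) (tt x) tx0.
  have tfb : t (f (b *: t x)) = a *: t x by rewrite fb; apply: tp; rewrite lZ tt.
  have atx : a *: t x <> 0.
    by rewrite -tfb => tfb0; apply: bz; apply: tfinj => //; rewrite lZ tt.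
  exists a; split; last by move=> ax; apply: atx; rewrite -lZ ax raddf0.
  (* The first summand goes to [a *: t x] and the second to itself, so the image under [u] is
     [a *: x]. *)
  exists (b *: t x + k (a *: x)); rewrite [u _]raddfD /= !uE.
  rewrite tk !raddf0 add0r kk [t (b *: _)]lZ tt tfb [k (b *: _)]lZ kt scaler0 addr0.
  by rewrite lZ -scalerDr tE subrK.
have tM : preserves t by apply: preserves_idempotent.
have ftM : preserves (f \o t).
  apply: preserves_corner => // x Mx.
  have -> : t (f (t x)) = u (t x) by rewrite uE tt kt addr0.
  by apply: Minv => //; apply: tM.
by apply: (preserves_add fkM ftM) => x; rewrite /= -raddfD tE addrC subrK.
Qed.

Lemma endomorphism_preserved (f : {linear E -> E}) : preserves f.
Proof.
have lZ (h : {linear E -> E}) a x : h (a *: x) = a *: h x by exact: linearZ.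
pose r x y := x = f y -> y = 0.
have [||N [Ns _ Nr Nmax]] := @max_submod _ _ r (fun x : E => x = 0).
- by split=> // a x y -> ->; rewrite scaler0 addr0.
- by move=> x y _ ->.
(* The hull of [N] still satisfies [r]: if [y = f z] there with [z] nonzero, scaling first [z] and
   then [y] into [N] contradicts [r] on [N]. By maximality [N] is its own hull. *)
have [e [ee eN ess]] := hull_idempotent Einj Ns.
have {ee ess} Ne x : N (e x).
  apply: (Nmax _ (submod_fix e) eN _ (e x) (ee x)) => y z ey ez yz.
  apply: contrapT => z0; have [a [Naz az0]] := ess z ez z0.
  have ay0 : a *: y <> 0.
    move=> ay0; apply: az0; apply: (Nr 0); [exact: submod0|exact: Naz|].
    by rewrite lZ -yz ay0.
  have eay : e (a *: y) = a *: y by rewrite lZ ey.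
  have [b [Nbay]] := ess _ eay ay0; rewrite yz -!lZ => bz; apply: bz.
  rewrite (Nr (b *: (a *: y)) (b *: (a *: z))) ?raddf0 //; first exact: submodZ.
  by rewrite !lZ yz.
(* The map on [N + f(N)] that kills [N] and inverts [f] on [f(N)]; extended and followed by [e] it
   becomes [q], with image in [N]. *)
pose G x y := exists n, [/\ N n, N y & x = n + f y].
have GP : linear_rel G.
  split.
  - by exists 0; rewrite raddf0 addr0; split=> //; apply: submod0.
  - move=> a x y x' y' [n [Nn Ny ->]] [n' [Nn' Ny' ->]].
    exists (a *: n + n'); case: (Ns) => _ NP.
    by rewrite linearP scalerDr addrACA; split=> //; apply: NP.
  - move=> y [n [Nn Ny /esym/eqP]]; rewrite addr_eq0 => /eqP nE.
    by apply: (Nr (- n) y) => //; [apply: submodN | rewrite nE opprK].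
have [h hG] := extend_linear_rel Einj GP.
have [q qE] : exists q : {linear E -> E}, forall x, q x = e (h x).
  by exists (e \o h).
have Nq x : N (q x) by rewrite qE; apply: Ne.
have qN n : N n -> q n = 0.
  move=> Nn; rewrite qE (hG n 0) ?raddf0 //; exists n.
  by rewrite raddf0 addr0; split=> //; apply: submod0.
have qf n : N n -> q (f n) = n.
  move=> Nn; rewrite qE (hG _ n) ?eN //; exists 0.
  by rewrite add0r; split=> //; apply: submod0.
have [p2 p2E] : exists p2 : {linear E -> E}, forall x, p2 x = f (q x).
  by exists (f \o q).
have [p1 p1E] : exists p1 : {linear E -> E}, forall x, p1 x = e (x - p2 x).
  by exists (e \o (idfun \- p2)).
have Np1 x : N (p1 x) by rewrite p1E; apply: Ne.
have p1N n : N n -> p1 n = n by move=> Nn; rewrite p1E p2E qN // raddf0 subr0 eN.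
have p2N n : N n -> p2 n = 0 by move=> Nn; rewrite p2E qN // raddf0.
have p2f n : N n -> p2 (f n) = f n by move=> Nn; rewrite p2E qf.
have p1f n : N n -> p1 (f n) = 0 by move=> Nn; rewrite p1E p2f // subrr raddf0.
have [p3 p3E] : exists p3 : {linear E -> E}, forall x, p3 x = x - p1 x - p2 x.
  by exists ((idfun \- p1) \- p2).
have p3N n : N n -> p3 n = 0 by move=> Nn; rewrite p3E p1N // p2N // subrr subr0.
have p3f n : N n -> p3 (f n) = 0 by move=> Nn; rewrite p3E p1f // p2f // subr0 subrr.
have p3p3 x : p3 (p3 x) = p3 x.
  by rewrite [in LHS](p3E x) !raddfB /= (p3N (p1 x)) // p2E (p3f (q x)) // !subr0.
have fp1M : preserves (f \o p1).
  by apply: preserves_square_zero => x; rewrite /= p1f // raddf0.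
have fp2M : preserves (f \o p2).
  apply: preserves_corner => [x|]; first by rewrite (p2E x) p2f.
  have qM : preserves q by apply: preserves_square_zero => x; rewrite qN.
  have nM : preserves (p2 \o f \o f \o p1).
    apply: (@preserves_square_zero (p2 \o f \o f \o p1)) => x /=.
    by rewrite [p1 (p2 _)](_ : _ = 0) ?raddf0 // p2E p1f.
  (* The two factors of square zero: [q] kills its own image in [N], and [p1 p2 = 0]. *)
  move=> x Mx; have -> : p2 (f (p2 x)) = (p2 \o f \o f \o p1) (q x).
    by rewrite /= p1N // (p2E x).
  by apply/nM/qM.
have fp3M : preserves (f \o p3).
  apply: preserves_corner => //.
  apply: (@preserves_locally_scalar p3 (p3 \o f \o p3)) => // [x|x p3x x0].
    by rewrite /= p3p3.
  have nNx : ~ N x by move=> Nx; apply: x0; rewrite -p3x p3N.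
  apply: contrapT => noab; apply: nNx.
  (* If no [a], [b] exist, [N] enlarged by [x] still satisfies [r]: applying [p3] to
     [a *: x + n = f (b *: x + m)] gives [a *: x = p3 (f (b *: x))], so [b *: x = 0], then
     [a *: x = 0], and [n = f m] forces [m = 0]. *)
  apply: (Nmax _ (submod_add_span x Ns)) => [n Nn||]; last 2 first.
  - move=> _ _ [a [n [Nn ->]]] [b [m [Nm ->]]] eq_f.
    have ax : a *: x = p3 (f (b *: x)).
      have := congr1 p3 eq_f; rewrite (raddfD f) !(raddfD p3) /= lZ p3x.
      by rewrite (p3N n) // (p3f m) // !addr0.
    have bx0 : b *: x = 0.
      apply: contrapT => bx0; apply: noab; exists a, b; split=> //=.
      by rewrite lZ p3x -ax.
    rewrite bx0 add0r; apply: (Nr n m) => //.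
    by rewrite -[n]add0r -[in RHS](add0r m) -{2}bx0 -eq_f ax bx0 !raddf0.
  - by exists 1, 0; rewrite scale1r addr0; split=> //; apply: submod0.
  - by exists 0, n; rewrite scale0r add0r.
have fp12M : preserves (f \o (p1 \+ p2)).
  by apply: (preserves_add fp1M fp2M) => x; rewrite /= raddfD.
apply: (preserves_add fp12M fp3M) => x.
by rewrite /= -raddfD p3E -[x - _ - _]addrA -opprD addrCA subrr addr0.
Qed.

End PreservedSubmodule.


(** * The equivalence of the two invariance properties *)

Theorem theorem5 (F : fieldType) (A : algType F)
  (hF : exists x y z : F, [/\ x != y, y != z & x != z])
  (M : lmodType A^c) :
  automorphism_invariant M <-> quasi_injective M.
Proof.
split=> [Minv L Ls f fP | Mqi E iota [iinj Einj ess] sigma sbij m].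
  have [E [iota hull]] := injective_hull_exists M.
  have [iinj Einj _] := hull.
  have [c [c0 c1]] : exists c : F, c != 0 /\ c != 1.
    have [x [y [z [xy yz xz]]]] := hF.
    (* The affine map taking [x] to 0 and [y] to 1 takes [z] to a third value. *)
    exists ((z - x) / (y - x)).
    have yx0 : y - x != 0 by rewrite subr_eq0 eq_sym.
    rewrite mulf_neq0 ?invr_eq0 // ?subr_eq0 1?eq_sym //; split=> //.
    apply/eqP=> /(congr1 (fun u => u * (y - x))); rewrite divfK // mul1r.
    by move/addIr => zy; rewrite zy eqxx in yz.
  pose G x y := exists m, [/\ L m, x = iota m & y = iota (f m)].
  have [L0 LP] := Ls.
  have f0 : f 0 = 0.
    have := fP 1 0 0 L0 L0; rewrite !scale1r addr0 => /esym/eqP.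
    by rewrite -subr_eq0 addrK => /eqP.
  have GP : linear_rel G.
    split.
    - by exists 0; rewrite f0 !raddf0.
    - move=> a _ _ _ _ [m [Lm -> ->]] [m' [Lm' -> ->]].
      by exists (a *: m + m'); rewrite fP // !linearP; split=> //; apply: LP.
    - move=> _ [m [Lm m0 ->]]; suff -> : m = 0 by rewrite f0 raddf0.
      by apply: iinj; rewrite -m0 raddf0.
  have [g gG] := extend_linear_rel Einj GP.
  have gM : preserves (fun x => exists m, x = iota m) g.
    apply: (endomorphism_preserved Einj (submod_im iota) _ c0 c1) => s sbij _ [m ->].
    exact: Minv hull s sbij m.
  (* As [g] preserves the image of [iota], it descends to an endomorphism of [M]. *)
  have [||h hP] := @total_linear_rel _ M M (fun m m' => g (iota m) = iota m').
    - split=> [|a x y x' y' gx gy|y]; first by rewrite !raddf0.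
        by rewrite !linearP gx gy.
      by rewrite !raddf0 => y0; apply: iinj; rewrite -y0 raddf0.
    - by move=> m; apply: gM; exists m.
  exists h => m Lm; apply: hP; apply: gG; by exists m.
(* On [L], [sigma] is already a map into [M]; quasi-injectivity extends it to [g] on [M], and [h]
   extends [g] to [E]. It remains to see that [sigma] and [h] agree on [M]. *)
pose L m := exists m', sigma (iota m) = iota m'.
have LP : linear_rel (fun m m' => sigma (iota m) = iota m').
  split=> [|a x y x' y' gx gy|y]; first by rewrite !raddf0.
    by rewrite !linearP gx gy.
  by rewrite !raddf0 => y0; apply: iinj; rewrite -y0 raddf0.
have [LP0 LPD _] := LP.
have Ls : is_submodule L.
  split=> [|a x y [x' xx'] [y' yy']]; first by exists 0.
  by exists (a *: x' + y'); apply: LPD.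
have /choice[f fP] : forall m, exists m', L m -> sigma (iota m) = iota m'.
  by move=> x; have [[x' xx']|nL] := pselect (L x); [exists x' | exists 0].
have [|g gf] := Mqi L Ls f.
  move=> a x y Lx Ly; apply: (linear_rel_functional LP).
    by apply: fP; case: Ls => _; apply.
  by apply: LPD; apply: fP.
have [h hg] := Einj _ _ iota (iota \o g : {linear M -> E}) iinj.
exists (g m); apply/eqP; rewrite -subr_eq0 -[iota (g m)]/((iota \o g) m) -hg.
pose d : {linear E -> E} := sigma \- h.
(* By essentiality it suffices that [d(M)] meets [M] in 0. If [d (iota x)] lies in [M], so does
   [sigma (iota x)]; then [x] is in [L], where [g] agrees with [f], and [d (iota x) = 0]. *)
apply/eqP; apply: (ess (fun y => exists m, y = d (iota m))); last by exists m.
  exact: (submod_im (d \o iota : {linear M -> E})).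
move=> m' [x dx]; rewrite dx.
have im' : iota m' = sigma (iota x) - iota (g x) by rewrite dx /= hg.
have Lx : L x by exists (m' + g x); rewrite raddfD /= im' subrK.
by rewrite /= hg /= gf // -fP // subrr.
Qed.
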